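(* Let $\mathcal{H}_1, \mathcal{H}_2$ be right quaternionic Hilbert spaces and let $J_1, J_2$ be anti self-adjoint unitary operators on $\mathcal{H}_1$ and $\mathcal{H}_2$, respectively. Let $m \in \mathbb{S}$ and let $T : \mathcal{D}(T) \subseteq (\mathcal{H}_1)^{J_1 m}_{+} \to (\mathcal{H}_2)^{J_2 m}_{+}$ be a $\mathbb{C}_m$-linear operator. Then there exists a unique right $\mathbb{H}$-linear operator $\widetilde{T} : \mathcal{D}(\widetilde{T}) \subseteq \mathcal{H}_1 \to \mathcal{H}_2$ such that $\mathcal{D}(\widetilde{T}) \cap (\mathcal{H}_1)^{J_1 m}_{+} = \mathcal{D}(T)$, $J_1(\mathcal{D}(\widetilde{T})) \subset \mathcal{D}(\widetilde{T})$, and $\widetilde{T}(x) = T(x)$ for every $x \in \mathcal{D}(T)$. Furthermore: (1) If $T : (\mathcal{H}_1)^{J_1 m}_{+} \to (\mathcal{H}_2)^{J_2 m}_{+}$ is bounded (defined on all of $(\mathcal{H}_1)^{J_1 m}_{+}$), then $\widetilde{T} \in \mathcal{B}(\mathcal{H}_1,\mathcal{H}_2)$ and $\|\widetilde{T}\| = \|T\|$. (2) $J_2 \widetilde{T} = \widetilde{T} J_1$ on $\mathcal{D}(\widetilde{T})$. On the other hand, let $V : \mathcal{D}(V) \subseteq \mathcal{H}_1 \to \mathcal{H}_2$ be a right $\mathbb{H}$-linear operator. Then $V = \widetilde{U}$ for a unique $\mathbb{C}_m$-linear operator $U : \mathcal{D}(V) \cap (\mathcal{H}_1)^{J_1 m}_{+}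 \to (\mathcal{H}_2)^{J_2 m}_{+}$ if and only if $J_1(\mathcal{D}(V)) \subseteq \mathcal{D}(V)$ and $J_2 V(x) = V J_1(x)$ for all $x \in \mathcal{D}(V)$.
   Context: $\mathbb{H}$ is the division ring of quaternions, $\mathbb{S} = \{q \in \mathbb{H} : \overline{q} = -q,\ |q| = 1\}$, and for $m \in \mathbb{S}$, $\mathbb{C}_m = \{\alpha + m\beta : \alpha,\beta \in \mathbb{R}\}$, identified with $\mathbb{C}$ via $\alpha + m\beta \mapsto \alpha + i\beta$. A right quaternionic Hilbert space is a right $\mathbb{H}$-module $\mathcal{H}$ with a map $\langle\cdot|\cdot\rangle : \mathcal{H}\times\mathcal{H}\to\mathbb{H}$ satisfying $\langle x|x\rangle \ge 0$ with equality iff $x=0$, $\langle x|y+zq\rangle = \langle x|y\rangle + \langle x|z\rangle q$, and $\langle x|y\rangle = \overline{\langle y|x\rangle}$, complete for the norm $\|x\| = \sqrt{\langle x|x\rangle}$. A right $\mathbb{H}$-linear operator $T$ from $\mathcal{H}_1$ to $\mathcal{H}_2$ has as domain $\mathcal{D}(T)$ a right $\mathbb{H}$-linear subspace of $\mathcal{H}_1$ and satisfies $T(xq+y) = T(x)q + T(y)$; $\mathcal{B}(\mathcal{H}_1,\mathcal{H}_2)$ is the set of bounded ones defined on all of $\mathcal{H}_1$. An operator $J \in \mathcal{B}(\mathcal{H})$ is anti self-adjoint and unitary if $J^* = -J$ and $J^2 = -I$; then $\mathcal{H}^{Jm}_{+} = \{x \in \mathcal{H} : J(x) = x\cdot m\}$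 is a $\mathbb{C}_m$-Hilbert space (right scalar multiplication by $\mathbb{C}_m$, inherited inner product). A $\mathbb{C}_m$-linear operator between such spaces has as domain a $\mathbb{C}_m$-linear subspace. For a $\mathbb{C}_m$-linear operator $U$, $\widetilde{U}$ denotes its extension characterized by the three conditions in the first part of the claim (with $T$ replaced by $U$). *)

(* Defs.v *)
From HB Require Import structures.
From mathcomp Require Import all_boot all_order all_algebra ring.
From mathcomp Require Import classical_sets reals.

Set Implicit Arguments.
Unset Strict Implicit.
Unset Printing Implicit Defensive.

Import Order.TTheory GRing.Theory Num.Theory.
Local Open Scope classical_set_scope.
Local Open Scope ring_scope.

(** * Quaternions *)

Record quat (R : Type) : Type := Quat { q0 : R; q1 : R; q2 : R; q3 : R }.

Definition tuple_of_quat (R : Type) (q : quat R) := (q0 q, q1 q, q2 q, q3 q).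
Definition quat_of_tuple (R : Type) (t : R * R * R * R) :=
  Quat t.1.1.1 t.1.1.2 t.1.2 t.2.

Lemma tuple_of_quatK (R : Type) :
  cancel (@tuple_of_quat R) (@quat_of_tuple R).
Proof. by case. Qed.

HB.instance Definition _ (R : eqType) :=
  Equality.copy (quat R) (can_type (@tuple_of_quatK R)).
HB.instance Definition _ (R : choiceType) :=
  Choice.copy (quat R) (can_type (@tuple_of_quatK R)).

Section QuatRing.
Variable R : realType.
Implicit Types p q r : quat R.

Definition quat_zero : quat R := Quat 0 0 0 0.
Definition quat_one : quat R := Quat 1 0 0 0.
Definition quat_opp p := Quat (- q0 p) (- q1 p) (- q2 p) (- q3 p).
Definition quat_add p q :=
  Quat (q0 p + q0 q) (q1 p + q1 q) (q2 p + q2 q) (q3 p + q3 q).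
Definition quat_mul p q :=
  Quat (q0 p * q0 q - q1 p * q1 q - q2 p * q2 q - q3 p * q3 q)
       (q0 p * q1 q + q1 p * q0 q + q2 p * q3 q - q3 p * q2 q)
       (q0 p * q2 q - q1 p * q3 q + q2 p * q0 q + q3 p * q1 q)
       (q0 p * q3 q + q1 p * q2 q - q2 p * q1 q + q3 p * q0 q).

Lemma quat_addA : associative quat_add.
Proof. by move=> [????] [????] [????]; congr Quat; rewrite /= addrA. Qed.
Lemma quat_addC : commutative quat_add.
Proof. by move=> [????] [????]; congr Quat; rewrite /= addrC. Qed.
Lemma quat_add0 : left_id quat_zero quat_add.
Proof. by move=> [????]; congr Quat; rewrite /= add0r. Qed.
Lemma quat_addN : left_inverse quat_zero quat_opp quat_add.
Proof. by move=> [????]; congr Quat; rewrite /= addNr. Qed.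

HB.instance Definition _ :=
  GRing.isZmodule.Build (quat R) quat_addA quat_addC quat_add0 quat_addN.

Lemma quat_mulA : associative quat_mul.
Proof. by move=> [????] [????] [????]; congr Quat => /=; ring. Qed.
Lemma quat_mul1l : left_id quat_one quat_mul.
Proof. by move=> [????]; congr Quat => /=; ring. Qed.
Lemma quat_mul1r : right_id quat_one quat_mul.
Proof. by move=> [????]; congr Quat => /=; ring. Qed.
Lemma quat_mulDl : left_distributive quat_mul +%R.
Proof. by move=> [????] [????] [????]; congr Quat => /=; ring. Qed.
Lemma quat_mulDr : right_distributive quat_mul +%R.
Proof. by move=> [????] [????] [????]; congr Quat => /=; ring. Qed.
Lemma quat_one_neq0 : quat_one != 0.
Proof. by apply/eqP => -[] /eqP; rewrite oner_eq0. Qed.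

HB.instance Definition _ := GRing.Zmodule_isNzRing.Build (quat R)
  quat_mulA quat_mul1l quat_mul1r quat_mulDl quat_mulDr quat_one_neq0.

Definition quat_real (a : R) : quat R := Quat a 0 0 0.
Definition quat_conj q : quat R := Quat (q0 q) (- q1 q) (- q2 q) (- q3 q).
Definition quat_abs q : R :=
  Num.sqrt (q0 q ^+ 2 + q1 q ^+ 2 + q2 q ^+ 2 + q3 q ^+ 2).

(* the relation [q >= 0] presupposes that [q] is real *)
Definition quat_nonneg q : Prop := exists2 a : R, 0 <= a & q = quat_real a.

Definition imag_sphere : set (quat R) :=
  [set q | quat_conj q = - q /\ quat_abs q = 1].

Definition Cslice (m : quat R) : set (quat R) :=
  [set q | exists a b : R, q = quat_real a + m * quat_real b].

End QuatRing.

(** * Right quaternionic Hilbert spaces *)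

(* A right module over a ring is a left module over the converse ring. *)
Definition rscale (R : realType) (H : lmodType (quat R)^c)
  (x : H) (q : quat R) : H := (q : (quat R)^c) *: x.
Notation "x *; q" := (rscale x q) (at level 40, left associativity).

HB.mixin Record isQuatHilbert (R : realType) H
    of GRing.Lmodule (quat R)^c H := {
  inner : H -> H -> quat R;
  inner_nonneg : forall x, quat_nonneg (inner x x);
  inner_eq0 : forall x, inner x x = 0 <-> x = 0;
  inner_linr : forall x y z (q : quat R),
    inner x (y + z *; q) = inner x y + inner x z * q;
  inner_conj : forall x y, inner x y = quat_conj (inner y x);
  inner_complete : forall u : nat -> H,
    let norm x := Num.sqrt (q0 (inner x x)) in
    (forall e : R, 0 < e -> exists N : nat, forall i j : nat,
       (N <= i)%N -> (N <= j)%N -> norm (u i - u j) < e) ->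
    exists l : H, forall e : R, 0 < e -> exists N : nat, forall i : nat,
       (N <= i)%N -> norm (u i - l) < e
}.

#[short(type="quatHilbertType")]
HB.structure Definition QuatHilbert (R : realType) :=
  { H of isQuatHilbert R H & GRing.Lmodule (quat R)^c H }.

Definition hnorm (R : realType) (H : quatHilbertType R) (x : H) : R :=
  Num.sqrt (q0 (inner x x)).

(** * Partially defined operators *)

(* The values of the underlying total function outside of [dom] are
   irrelevant: operators are compared by [op_eq], not by [=]. *)
Record op (R : realType) (H1 H2 : quatHilbertType R) := Op {
  dom : set H1;
  opfun :> H1 -> H2
}.

Section Operators.
Variables (R : realType) (H1 H2 : quatHilbertType R).
Implicit Types S T : op H1 H2.

Definition op_eq S T : Prop :=
  dom S = dom T /\ forall x, dom S x -> S x = T x.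

Definition exists_unique_op (P : op H1 H2 -> Prop) : Prop :=
  exists2 T, P T & forall S, P S -> op_eq S T.

(* linearity with respect to right multiplication by the scalars in [K] *)
Definition linear_over (K : set (quat R)) T : Prop :=
  [/\ dom T 0,
      forall x y q, K q -> dom T x -> dom T y -> dom T (x *; q + y) &
      forall x y q, K q -> dom T x -> dom T y ->
        T (x *; q + y) = T x *; q + T y].

Definition right_linear T : Prop := linear_over setT T.

Definition bounded_op T : Prop :=
  exists k : R, forall x, dom T x -> hnorm (T x) <= k * hnorm x.

Definition opnorm T : R :=
  sup [set r | exists x, [/\ dom T x, hnorm x <= 1 & r = hnorm (T x)]].

Definition everywhere_bounded T : Prop :=
  [/\ right_linear T, dom T = setT & bounded_op T].

End Operators.

(* [S] is the adjoint of the everywhere defined operator [T] *)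
Definition is_adjoint (R : realType) (H1 H2 : quatHilbertType R)
    (T : op H1 H2) (S : op H2 H1) : Prop :=
  dom S = setT /\ forall x y, inner (S x) y = inner x (T y).

Definition op_opp (R : realType) (H1 H2 : quatHilbertType R)
  (T : op H1 H2) : op H1 H2 := Op (dom T) (fun x => - T x).

Definition anti_selfadjoint_unitary (R : realType) (H : quatHilbertType R)
    (J : op H H) : Prop :=
  [/\ everywhere_bounded J, is_adjoint J (op_opp J) &
      forall x, J (J x) = - x].

Definition Hplus (R : realType) (H : quatHilbertType R) (J : op H H)
  (m : quat R) : set H := [set x | J x = x *; m].

Section Extension.
Variables (R : realType) (H1 H2 : quatHilbertType R).
Variables (J1 : op H1 H1) (J2 : op H2 H2) (m : quat R).

Definition slice_operator (T : op H1 H2) : Prop :=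
  [/\ dom T `<=` Hplus J1 m,
      forall x, dom T x -> Hplus J2 m (T x) &
      linear_over (Cslice m) T].

Definition is_tilde (T Tt : op H1 H2) : Prop :=
  [/\ right_linear Tt,
      dom Tt `&` Hplus J1 m = dom T,
      forall x, dom Tt x -> dom Tt (J1 x) &
      forall x, dom T x -> Tt x = T x].

End Extension.

(* Main.v *)
(** Pick [n] in the sphere with [n m = - m n]. With [P x = (x - J x m) / 2], which
    takes values in the slice space [J x = x m], every vector decomposes as
    [x = P x - P (x n) n]. Any right linear extension of [T] with [J1]-invariant
    domain must therefore be [x |-> T (P x) - T (P (x n)) n], defined where both
    [P x] and [P (x n)] lie in the domain of [T]. On the slice space the inner
    product commutes with [m], so the two summands are orthogonal for the real
    part of the inner product, and the operator norm does not change. *)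
Require Import Defs.
From mathcomp Require Import all_boot all_order all_algebra ring lra.
From mathcomp Require Import classical_sets reals.
Set Implicit Arguments.
Unset Strict Implicit.
Unset Printing Implicit Defensive.
Import Order.TTheory GRing.Theory Num.Theory.
Local Open Scope classical_set_scope.
Local Open Scope ring_scope.

(** * Imaginary units, the slices [Cslice m], and the splitting of the quaternions along a slice *)

Section Quaternions.
Variable R : realType.
Implicit Types p q m n : quat R.

Let quat_ext p q :
  q0 p = q0 q -> q1 p = q1 q -> q2 p = q2 q -> q3 p = q3 q -> p = q.
Proof. by case: p => ????; case: q => ???? /= -> -> -> ->. Qed.

Lemma quat_realC (a : R) q : quat_real a * q = q * quat_real a.
Proof. by case: q => ????; apply: quat_ext => /=; ring. Qed.

Lemma quat_real_half q :
  q * quat_real (2^-1 : R) + q * quat_real (2^-1 : R) = q.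
Proof. by case: q => ????; apply: quat_ext => /=; field. Qed.

Lemma q0D p q : q0 (p + q) = q0 p + q0 q. Proof. by []. Qed.

Lemma q0N q : q0 (- q) = - q0 q. Proof. by []. Qed.

Lemma q0_mulC p q : q0 (p * q) = q0 (q * p).
Proof. by case: p => ????; case: q => ???? /=; ring. Qed.

Lemma quat_conjM p q : quat_conj (p * q) = quat_conj q * quat_conj p.
Proof. by case: p => ????; case: q => ????; apply: quat_ext => /=; ring. Qed.

Lemma quat_conjD p q : quat_conj (p + q) = quat_conj p + quat_conj q.
Proof. by case: p => ????; case: q => ????; apply: quat_ext => /=; ring. Qed.

Lemma imag_sphereP m : imag_sphere m <->
  q0 m = 0 /\ q1 m ^+ 2 + q2 m ^+ 2 + q3 m ^+ 2 = 1.
Proof.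
case: m => m0 m1 m2 m3; rewrite /imag_sphere /quat_abs /=; split.
  case=> -[m0N] ms.
  have m00 : m0 = 0 by lra.
  split=> //; move: ms; rewrite m00 expr0n add0r => /(congr1 (fun x => x ^+ 2)).
  by rewrite sqr_sqrtr ?expr1n // !addr_ge0 ?sqr_ge0.
case=> -> ms; split; first by apply: quat_ext => //=; rewrite oppr0.
by rewrite expr0n add0r ms sqrtr1.
Qed.

Lemma imag_sphere_mulss m : imag_sphere m -> m * m = -1.
Proof.
case/imag_sphereP; case: m => m0 m1 m2 m3 /= -> ms.
by apply: quat_ext => /=; [rewrite -ms| | |]; ring.
Qed.

(** Imaginary units that are orthogonal as vectors of $\mathbb{R}^3$ anticommute, so any unit vector
    orthogonal to [m] serves. *)
Lemma imag_sphere_anticomm m : imag_sphere m ->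
  exists2 n, imag_sphere n & n * m = - (m * n).
Proof.
case/imag_sphereP; case: m => m0 m1 m2 m3 /= -> ms.
have s_ge0 : 0 <= m1 ^+ 2 + m2 ^+ 2 by rewrite addr_ge0 ?sqr_ge0.
have [/eqP|s_neq0] := eqVneq (m1 ^+ 2 + m2 ^+ 2) 0.
  (* Here [m] is a multiple of the third unit, to which the first unit is orthogonal. *)
  rewrite paddr_eq0 ?sqr_ge0 // !sqrf_eq0 => /andP[/eqP-> /eqP->].
  exists (Quat 0 1 0 0); first by apply/imag_sphereP; split=> //=; ring.
  by apply: quat_ext => /=; ring.
pose s := Num.sqrt (m1 ^+ 2 + m2 ^+ 2).
have ss : s ^+ 2 = m1 ^+ 2 + m2 ^+ 2 by rewrite sqr_sqrtr.
have s0 : s != 0 by rewrite -sqrf_eq0 ss.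
(* The first two imaginary coordinates of [m] are rotated by a right angle and normalised. *)
exists (Quat 0 (- m2 / s) (m1 / s) 0).
  apply/imag_sphereP; split=> //=.
  by rewrite !expr_div_n sqrrN expr0n addr0 -mulrDl addrC -ss mulfV // sqrf_eq0.
by apply: quat_ext => /=; ring.
Qed.

(** The slice is the centraliser of [m]: commuting with [m] makes the cross product of the imaginary
    parts vanish, so that of [q] is parallel to [m]. *)
Lemma Cslice_comm m q : imag_sphere m -> Cslice m q <-> q * m = m * q.
Proof.
move=> mS; split.
  by case=> a [b ->]; rewrite mulrDl mulrDr quat_realC -!mulrA quat_realC.
case/imag_sphereP: mS; case: m => m0 m1 m2 m3 /= -> ms.
case: q => a b c d [_ e1 e2 e3].
(* As [m] is a unit vector, its coefficient is the scalar product of the imaginary parts. *)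
exists a, (b * m1 + c * m2 + d * m3).
have {}e1 : c * m3 = d * m2 by lra.
have {}e2 : d * m1 = b * m3 by lra.
have {}e3 : b * m2 = c * m1 by lra.
apply: quat_ext => /=; first by ring.
- transitivity (b * (m1 ^+ 2 + m2 ^+ 2 + m3 ^+ 2)); first by rewrite ms mulr1.
  transitivity (b * m1 ^+ 2 + b * m2 * m2 + b * m3 * m3); first by ring.
  by rewrite e3 -e2; ring.
- transitivity (c * (m1 ^+ 2 + m2 ^+ 2 + m3 ^+ 2)); first by rewrite ms mulr1.
  transitivity (c * m1 * m1 + c * m2 ^+ 2 + c * m3 * m3); first by ring.
  by rewrite e1 -e3; ring.
- transitivity (d * (m1 ^+ 2 + m2 ^+ 2 + m3 ^+ 2)); first by rewrite ms mulr1.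
  transitivity (d * m1 * m1 + d * m2 * m2 + d * m3 ^+ 2); first by ring.
  by rewrite e2 -e1; ring.
Qed.

(** The $\mathbb{C}_m$-component of [q]: the projection onto the slice space for [J] equal to left
    multiplication by [m] on the quaternions. *)
Definition slice_part m q := (q - m * q * m) * quat_real (2^-1 : R).

Lemma slice_part_Cslice m q : imag_sphere m -> Cslice m (slice_part m q).
Proof.
move=> mS; apply/Cslice_comm => //.
rewrite /slice_part -mulrA quat_realC !mulrA.
congr (_ * _); rewrite mulrBl mulrBr !mulrA imag_sphere_mulss //.
rewrite -[_ * m * m]mulrA imag_sphere_mulss // mulrN1 !mulN1r mulNr !opprK.
by rewrite addrC.
Qed.

(* The splitting [H = C_m + C_m n]. *)
Lemma slice_part_decomp m n q : imag_sphere m -> imag_sphere n ->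
  n * m = - (m * n) -> q = slice_part m q - slice_part m (q * n) * n.
Proof.
move=> mS nS nm; rewrite /slice_part -[(_ - m * (q * n) * m) * _ * n]mulrA.
rewrite quat_realC [(_ - m * (q * n) * m) * (n * _)]mulrA -mulrBl.
rewrite [(q * n - _) * n]mulrBl -[q * n * n]mulrA.
rewrite imag_sphere_mulss // mulrN1.
have -> : m * (q * n) * m * n = m * q * m.
  rewrite -!mulrA [n * (m * n)]mulrA nm mulNr -mulrA imag_sphere_mulss //.
  by rewrite mulrN1 opprK.
rewrite opprB opprK [m * q * m + q]addrC addrACA addNr addr0 mulrDl.
by rewrite quat_real_half.
Qed.

End Quaternions.

(** * Module rules in right-handed notation *)

Section RightScaling.
Variables (R : realType) (H : lmodType (quat R)^c).
Implicit Types (x y : H) (p q : quat R).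

Lemma rscaleA x p q : x *; p *; q = x *; (p * q).
Proof. exact: scalerA. Qed.

Lemma rscaleDl x y q : (x + y) *; q = x *; q + y *; q.
Proof. exact: scalerDr. Qed.

Lemma rscaleDr x p q : x *; (p + q) = x *; p + x *; q.
Proof. exact: scalerDl. Qed.

Lemma rscaleNl x q : (- x) *; q = - (x *; q).
Proof. exact: scalerN. Qed.

Lemma rscaleNr x q : x *; (- q) = - (x *; q).
Proof. exact: scaleNr. Qed.

Lemma rscaleBl x y q : (x - y) *; q = x *; q - y *; q.
Proof. exact: scalerBr. Qed.

Lemma rscaleBr x p q : x *; (p - q) = x *; p - x *; q.
Proof. exact: scalerBl. Qed.

Lemma rscale1 x : x *; 1 = x. Proof. exact: scale1r. Qed.

Lemma rscale0l q : (0 : H) *; q = 0. Proof. exact: scaler0. Qed.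

Lemma rscale_half x : x *; quat_real (2^-1 : R) + x *; quat_real (2^-1 : R) = x.
Proof.
by rewrite -rscaleDr -[quat_real _]mul1r quat_real_half rscale1.
Qed.

End RightScaling.

(** * Inner product and norm *)

Section HilbertNorm.
Variables (R : realType) (H : quatHilbertType R).
Implicit Types (x y z : H) (q : quat R).

Lemma innerDr x y z : inner x (y + z) = inner x y + inner x z.
Proof. by have := inner_linr x y z 1; rewrite rscale1 mulr1. Qed.

Lemma inner0r x : inner x 0 = 0.
Proof. by apply: (addrI (inner x 0)); rewrite -innerDr !addr0. Qed.

Lemma innerZr x y q : inner x (y *; q) = inner x y * q.
Proof. by have := inner_linr x 0 y q; rewrite inner0r !add0r. Qed.

Lemma innerNr x y : inner x (- y) = - inner x y.
Proof. by rewrite -[y in LHS]rscale1 -rscaleNr innerZr mulrN1. Qed.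

Lemma innerDl x y z : inner (x + y) z = inner x z + inner y z.
Proof. by rewrite inner_conj innerDr quat_conjD -!inner_conj. Qed.

Lemma innerZl x y q : inner (x *; q) y = quat_conj q * inner x y.
Proof. by rewrite inner_conj innerZr quat_conjM -inner_conj. Qed.

Lemma innerNl x y : inner (- x) y = - inner x y.
Proof.
rewrite inner_conj innerNr inner_conj; case: (inner x y) => * /=.
by rewrite /quat_conj /= !opprK.
Qed.

Lemma q0_innerC x y : q0 (inner x y) = q0 (inner y x).
Proof. by rewrite inner_conj. Qed.

Lemma q0_inner_ge0 x : 0 <= q0 (inner x x).
Proof. by case: (inner_nonneg x) => a a0 ->. Qed.

Lemma hnorm_ge0 x : 0 <= hnorm x. Proof. exact: sqrtr_ge0. Qed.

Lemma hnorm_sqr x : hnorm x ^+ 2 = q0 (inner x x).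
Proof. by rewrite sqr_sqrtr ?q0_inner_ge0. Qed.

Lemma hnorm0 : hnorm (0 : H) = 0.
Proof. by rewrite /hnorm inner0r sqrtr0. Qed.

Lemma hnorm_eq0 x : hnorm x = 0 -> x = 0.
Proof.
move=> /(congr1 (fun r => r ^+ 2)); rewrite hnorm_sqr expr0n /= => x0.
by apply/inner_eq0; case: (inner_nonneg x) x0 => a _ -> /= ->.
Qed.

Lemma hnorm_real x (a : R) : hnorm (x *; quat_real a) = `|a| * hnorm x.
Proof.
rewrite -sqrtr_sqr -sqrtrM ?sqr_ge0 // /hnorm innerZl innerZr.
by case: (inner x x) => * /=; congr Num.sqrt; ring.
Qed.

(** The value [inner x x] is real, hence central, so the factors [quat_conj q] and [q] cancel. *)
Lemma q0_inner_unit x q : imag_sphere q ->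
  q0 (inner (x *; q) (x *; q)) = q0 (inner x x).
Proof.
move=> qS; rewrite innerZl innerZr; case: (inner_nonneg x) => a _ ->.
by rewrite quat_realC mulrA (proj1 qS) mulNr imag_sphere_mulss // opprK mul1r.
Qed.

End HilbertNorm.

(** * Consequences of linearity over a set of scalars containing 1 *)

Section LinearOver.
Variables (R : realType) (H1 H2 : quatHilbertType R) (K : set (quat R)).
Variable (T : op H1 H2).
Hypotheses (linT : linear_over K T) (K1 : K 1).
Implicit Types x y : H1.

Lemma linear_over0 : T 0 = 0.
Proof.
case: linT => d0 _ /(_ 0 0 1 K1 d0 d0); rewrite !rscale1 addr0 => /esym T0.
by apply: (addrI (T 0)); rewrite T0 addr0.
Qed.

Lemma linear_overZ x q : K q -> dom T x ->
  dom T (x *; q) /\ T (x *; q) = T x *; q.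
Proof.
case: (linT) => d0 dD TD Kq dx; rewrite -[x *; q]addr0.
by split; [exact: dD|rewrite TD // linear_over0 addr0].
Qed.

Lemma linear_overD x y : dom T x -> dom T y ->
  dom T (x + y) /\ T (x + y) = T x + T y.
Proof.
case: (linT) => d0 dD TD dx dy; rewrite -[x in x + y]rscale1.
by split; [exact: dD|rewrite TD // rscale1].
Qed.

End LinearOver.

(** * Linearity of anti self-adjoint unitary operators, freed of domain conditions *)

Section AntiSelfadjointUnitary.
Variables (R : realType) (H : quatHilbertType R) (J : op H H).
Hypothesis hJ : anti_selfadjoint_unitary J.
Implicit Types x y : H.

Let domJ x : dom J x. Proof. by case: hJ => -[_ -> _]. Qed.

Lemma anti_selfadjoint_unitaryZ x q : J (x *; q) = J x *; q.
Proof.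
case: hJ => -[lJ _ _] _ _.
by case: (linear_overZ (q := q) lJ I I (domJ x)).
Qed.

Lemma anti_selfadjoint_unitaryD x y : J (x + y) = J x + J y.
Proof.
by case: hJ => -[lJ _ _] _ _; case: (linear_overD lJ I (domJ x) (domJ y)).
Qed.

Lemma anti_selfadjoint_unitary0 : J 0 = 0.
Proof. by case: hJ => -[lJ _ _] _ _; exact: (linear_over0 lJ I). Qed.

End AntiSelfadjointUnitary.

(** * The projection onto the slice space and the orthogonal decomposition *)

Section HplusProjection.
Variables (R : realType) (H : quatHilbertType R) (J : op H H) (m n : quat R).
Hypotheses (hJ : anti_selfadjoint_unitary J) (hm : imag_sphere m).
Hypotheses (hn : imag_sphere n) (nm : n * m = - (m * n)).
Implicit Types x y : H.

Let JZ := anti_selfadjoint_unitaryZ hJ.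
Let JD := anti_selfadjoint_unitaryD hJ.

Let JN x : J (- x) = - J x.
Proof. by rewrite -[x in LHS]rscale1 -rscaleNr JZ rscaleNr rscale1. Qed.

Let nmN : m * n = - (n * m). Proof. by rewrite nm opprK. Qed.

Let JJ x : J (J x) = - x. Proof. by case: hJ. Qed.

Definition Hplus_proj x := (x - J x *; m) *; quat_real (2^-1 : R).
Local Notation P := Hplus_proj.

Lemma Hplus_projD x y : P (x + y) = P x + P y.
Proof.
by rewrite /P JD -[RHS]rscaleDl [(J x + _) *; m]rscaleDl opprD addrACA.
Qed.

Lemma Hplus_projN x : P (- x) = - P x.
Proof. by rewrite /P JN -[RHS]rscaleNl [(- J x) *; m]rscaleNl opprD. Qed.

Lemma Hplus_proj_in x : Hplus J m (P x).
Proof.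
rewrite /Hplus /= /P JZ JD JN JZ JJ [RHS]rscaleA quat_realC -[RHS]rscaleA.
congr (_ *; _); rewrite rscaleBl [J x *; m *; m]rscaleA imag_sphere_mulss //.
by rewrite rscaleNr rscale1 rscaleNl !opprK addrC.
Qed.

Lemma Hplus_projJ x : P (J x) = P x *; m.
Proof. by rewrite -Hplus_proj_in /P JZ JD JN JZ. Qed.

(** On the slice space [J (x *; q) = x *; (m * q)], so projecting [x *; q] amounts to projecting the
    coefficient [q]. *)
Lemma Hplus_projZ x q : Hplus J m x -> P (x *; q) = x *; slice_part m q.
Proof.
by move=> Jx; rewrite /P JZ Jx !rscaleA -rscaleBr rscaleA /slice_part mulrA.
Qed.

(** Since $n m n = m$ and $n^2 = -1$, the term [P (x *; n) *; n] is the negative of the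
    complementary projection $(x + J(x) m)/2$. *)
Lemma Hplus_decomp x : x = P x - P (x *; n) *; n.
Proof.
have -> : P (x *; n) *; n = (- x - J x *; m) *; quat_real (2^-1 : R).
  rewrite /P rscaleA quat_realC -rscaleA JZ; congr (_ *; _).
  rewrite rscaleBl !rscaleA imag_sphere_mulss // rscaleNr rscale1.
  by rewrite nmN mulrN mulrA imag_sphere_mulss // mulN1r opprK.
by rewrite /P -rscaleBl opprB opprK [J x *; m + x]addrC addrACA addNr addr0
  rscaleDl rscale_half.
Qed.

(** Writing [x] by [Hplus_decomp] leaves slice vectors with coefficients [q] and [n * q]. An
    arbitrary scalar is thus reduced to scalars in $\mathbb{C}_m$, over which [T] is linear. *)
Lemma Hplus_projZE x q : P (x *; q) =
  P x *; slice_part m q - P (x *; n) *; slice_part m (n * q).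
Proof.
rewrite {1}[x]Hplus_decomp rscaleBl rscaleA Hplus_projD Hplus_projN.
by rewrite [P (P x *; q)]Hplus_projZ ?[P (_ *; (n * q))]Hplus_projZ //;
  exact: Hplus_proj_in.
Qed.

Lemma Hplus_proj_id x : Hplus J m x -> P x = x.
Proof.
move=> Jx; rewrite /P Jx rscaleA imag_sphere_mulss // rscaleNr rscale1 opprK.
by rewrite rscaleDl rscale_half.
Qed.

Lemma Hplus_proj_anti x : Hplus J m x -> P (x *; n) = 0.
Proof.
move=> Jx; rewrite Hplus_projZ // /slice_part -mulrA nm mulrN mulrA.
by rewrite imag_sphere_mulss // mulN1r opprK subrr mul0r; exact: scale0r.
Qed.

(* On the slice space [inner] commutes with [m], so [inner x (y *; n)] has no
   real part. *)
Lemma Hplus_pythagoras x y : Hplus J m x -> Hplus J m y ->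
  hnorm (x - y *; n) ^+ 2 = hnorm x ^+ 2 + hnorm y ^+ 2.
Proof.
move=> Jx Jy; rewrite !hnorm_sqr innerDl !innerDr !innerNl !innerNr opprK.
rewrite !(q0D, q0N) q0_inner_unit // (q0_innerC (y *; n)) innerZr.
(* The adjoint relation $J^* = -J$ moves [J] to the other slot, and the conjugate of [m] is
   [- m]. *)
have sm : inner x y * m = m * inner x y.
  rewrite -innerZr -Jy; case: hJ => _ [_ /(_ x y) /= <-] _.
  by rewrite Jx innerNl innerZl (proj1 hm) mulNr opprK.
suff -> : q0 (inner x y * n) = 0 by ring.
have : m * (inner x y * n * m) = inner x y * n.
  rewrite !mulrA -sm -!mulrA nm mulrN mulrA imag_sphere_mulss //.
  by rewrite mulN1r opprK.
(* The real part is invariant under cyclic permutation, so here it equals its own negative. *)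
move=> /(congr1 (@q0 R)); rewrite q0_mulC -mulrA imag_sphere_mulss //.
by rewrite mulrN1 q0N; lra.
Qed.

End HplusProjection.

(** * The explicit extension: uniqueness, linearity, commutation and bounds *)

Section Extension.
Variables (R : realType) (H1 H2 : quatHilbertType R).
Variables (J1 : op H1 H1) (J2 : op H2 H2) (m n : quat R).
Hypotheses (hJ1 : anti_selfadjoint_unitary J1).
Hypotheses (hJ2 : anti_selfadjoint_unitary J2).
Hypotheses (hm : imag_sphere m) (hn : imag_sphere n) (nm : n * m = - (m * n)).
Local Notation P := (Hplus_proj J1 m).

Lemma Cslice1 : Cslice m 1.
Proof. by apply/Cslice_comm; rewrite // mul1r mulr1. Qed.

Lemma Csliceid : Cslice m m. Proof. exact/Cslice_comm. Qed.

Definition tilde_ext (T : op H1 H2) : op H1 H2 :=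
  Op [set x | dom T (P x) /\ dom T (P (x *; n))]
     (fun x => T (P x) - T (P (x *; n)) *; n).

(** The domain of [S] is invariant under [J1], so it contains [P x] along with [x]; the intersection
    condition puts [P x] in [dom T], and [Hplus_decomp] then determines [S x]. *)
Lemma is_tilde_eq_ext (T S : op H1 H2) : slice_operator J1 J2 m T ->
  is_tilde J1 m T S -> op_eq S (tilde_ext T).
Proof.
move=> [_ _ lT] [lS dS JS ST].
have dZ q x : dom S x -> dom S (x *; q).
  by move=> dx; case: (linear_overZ (q := q) lS I I dx).
have dD x y : dom S x -> dom S y -> dom S (x + y).
  by move=> dx dy; case: (linear_overD lS I dx dy).
have dN x : dom S x -> dom S (- x).
  by move=> dx; rewrite -[x]rscale1 -rscaleNr; exact: dZ.
have dP x : dom S x -> dom T (P x).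
  move=> dx; rewrite -dS; split; last exact: Hplus_proj_in.
  by apply/dZ/dD => //; apply/dN/dZ/JS.
have dTS x : dom T x -> dom S x by rewrite -dS => -[].
split.
  apply/seteqP; split=> x /=.
    by move=> dx; split; apply: dP; rewrite //; exact: dZ.
  case=> /dTS d1 /dTS d2; rewrite [x](Hplus_decomp hJ1 hn nm).
  by apply: dD => //; apply/dN/dZ.
move=> x dx; have d1 := dP _ dx; have d2 := dP _ (dZ n _ dx).
rewrite [x in LHS](Hplus_decomp hJ1 hn nm) -rscaleNr.
case: (linear_overD lS I (dTS _ d1) (dZ (- n) _ (dTS _ d2))) => _ ->.
case: (linear_overZ (q := - n) lS I I (dTS _ d2)) => _ ->.
by rewrite !ST // rscaleNr.
Qed.

Lemma tilde_ext_linear (T : op H1 H2) : slice_operator J1 J2 m T ->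
  right_linear (tilde_ext T).
Proof.
move=> [_ _ lT].
have TZ q x : dom T x -> dom T (x *; slice_part m q) /\
    T (x *; slice_part m q) = T x *; slice_part m q.
  move=> dx; apply: (linear_overZ lT Cslice1) => //.
  exact: slice_part_Cslice.
have TD x y (dx : dom T x) (dy : dom T y) := linear_overD lT Cslice1 dx dy.
have TN x : dom T x -> dom T (- x) /\ T (- x) = - T x.
  move=> dx; have CN : Cslice m (-1).
    by apply/Cslice_comm => //; rewrite mulN1r mulrN1.
  by have := linear_overZ lT Cslice1 CN dx; rewrite !rscaleNr !rscale1.
have TP x q : dom T (P x) -> dom T (P (x *; n)) -> dom T (P (x *; q)) /\
    T (P (x *; q)) = T (P x) *; slice_part m q
                     - T (P (x *; n)) *; slice_part m (n * q).
  move=> d1 d2; rewrite (Hplus_projZE hJ1 hm hn nm).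
  have [a1 e1] := TZ q _ d1; have [a2 e2] := TZ (n * q) _ d2.
  have [a3 e3] := TN _ a2; have [a4 e4] := TD _ _ a1 a3.
  by rewrite e4 e3 e1 e2.
have P0 : P 0 = 0.
  by apply: (addrI (P 0)); rewrite -(Hplus_projD m hJ1) !addr0.
have TL x y q : dom (tilde_ext T) x -> dom (tilde_ext T) y ->
    dom (tilde_ext T) (x *; q + y) /\
    tilde_ext T (x *; q + y) = tilde_ext T x *; q + tilde_ext T y.
  case=> /= dx1 dx2 [dy1 dy2]; rewrite rscaleDl !(Hplus_projD m hJ1) rscaleA.
  have [a1 e1] := TP _ q dx1 dx2; have [a2 e2] := TP _ (q * n) dx1 dx2.
  have [b1 ->] := TD _ _ a1 dy1; have [b2 ->] := TD _ _ a2 dy2.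
  split=> //; rewrite e1 e2 rscaleDl opprD addrACA; congr (_ + _).
  rewrite [RHS]rscaleBl [in RHS]rscaleA.
  (* Splitting both [q] and [n * q] expresses the two sides through the same four slice
     coefficients. *)
  have := slice_part_decomp (n * q) hm hn nm; rewrite -[n * q * n]mulrA.
  have := slice_part_decomp q hm hn nm; set c := slice_part m q.
  set c' := slice_part m (q * n); set d := slice_part m (n * q).
  set d' := slice_part m _ => -> ->.
  rewrite !rscaleBr !rscaleBl !rscaleA !opprB addrACA [RHS]addrACA.
  by rewrite [- _ - _]addrC.
split=> [|x y q _ dx dy|x y q _ dx dy]; last 2 first.
- by case: (TL x y q dx dy).
- by case: (TL x y q dx dy).
by case: lT => d0 _ _; rewrite /= rscale0l P0.
Qed.

(** [J1] multiplies both slice components of [x] by [m], which [T] respects; [J2] does the same to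
    the values of [T]. *)
Lemma tilde_ext_J (T : op H1 H2) x : slice_operator J1 J2 m T ->
  dom (tilde_ext T) x -> dom (tilde_ext T) (J1 x) /\
  J2 (tilde_ext T x) = tilde_ext T (J1 x).
Proof.
move=> [_ rT lT] /= [d1 d2].
have PJ : P (J1 x *; n) = P (x *; n) *; m.
  by rewrite -(Hplus_projJ hJ1 hm) (anti_selfadjoint_unitaryZ hJ1).
rewrite PJ (Hplus_projJ hJ1 hm).
have [dm1 ->] := linear_overZ lT Cslice1 Csliceid d1.
have [dm2 ->] := linear_overZ lT Cslice1 Csliceid d2.
split=> //; rewrite -!rscaleNr (anti_selfadjoint_unitaryD hJ2).
by rewrite (anti_selfadjoint_unitaryZ hJ2) (rT _ d1) (rT _ d2).
Qed.

Lemma is_tilde_ext (T : op H1 H2) : slice_operator J1 J2 m T ->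
  is_tilde J1 m T (tilde_ext T).
Proof.
move=> sT; have [hT rT lT] := sT; have [d0 _ _] := lT.
(* For a slice vector the second component vanishes, so the extension reduces to [T]. *)
have ext x : Hplus J1 m x -> P x = x /\ P (x *; n) = 0.
  by move=> Jx; rewrite (Hplus_proj_id hm Jx) (Hplus_proj_anti hJ1 hm nm Jx).
split; first exact: tilde_ext_linear.
- apply/seteqP; split=> x /=.
    by case=> -[+ _] /ext[e _]; rewrite e.
  move=> dx; have [e1 e2] := ext x (hT _ dx).
  by rewrite e1 e2; split; [split|exact: hT].
- by move=> x /(tilde_ext_J sT)[].
- move=> x dx; have [e1 e2] := ext x (hT _ dx).
  by rewrite /= e1 e2 (linear_over0 lT Cslice1) rscale0l subr0.
Qed.

(** The Pythagorean identity holds in both source and target, so the squared bounds for the two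
    components add up. *)
Lemma tilde_ext_bound (T : op H1 H2) (k : R) : slice_operator J1 J2 m T ->
  0 <= k -> (forall x, dom T x -> hnorm (T x) <= k * hnorm x) ->
  forall x, dom (tilde_ext T) x -> hnorm (tilde_ext T x) <= k * hnorm x.
Proof.
move=> [hT rT lT] k0 bT x [d1 d2] /=.
rewrite -ler_sqr ?nnegrE ?mulr_ge0 ?hnorm_ge0 //.
rewrite (Hplus_pythagoras hJ2 hm hn nm (rT _ d1) (rT _ d2)).
rewrite [x in leRHS](Hplus_decomp hJ1 hn nm) exprMn.
rewrite (Hplus_pythagoras hJ1 hm hn nm (hT _ d1) (hT _ d2)) mulrDr -!exprMn.
by rewrite lerD // ler_sqr ?nnegrE ?mulr_ge0 ?hnorm_ge0 ?bT.
Qed.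

(** * The operator norm and its invariance under extension *)

Lemma op_eq_opnorm (S T : op H1 H2) : op_eq S T -> opnorm S = opnorm T.
Proof.
case=> dST ST; congr sup; apply/seteqP; split=> _ [x [dx x1 ->]]; exists x.
  by rewrite ST // -dST.
by rewrite ST // dST.
Qed.

Lemma le_opnorm (T : op H1 H2) x : bounded_op T -> dom T x -> hnorm x <= 1 ->
  hnorm (T x) <= opnorm T.
Proof.
move=> [k bT] dx x1; apply: ub_le_sup; last by exists x.
(* The constant in [bounded_op] may be negative, hence the absolute value. *)
exists `|k| => _ [y [dy y1 ->]]; apply: (le_trans (bT _ dy)).
apply: (@le_trans _ _ (`|k| * hnorm y)); last by rewrite ler_piMr.
by rewrite ler_wpM2r ?hnorm_ge0 ?ler_norm.
Qed.

Lemma opnorm_ge0 (T : op H1 H2) : bounded_op T -> dom T 0 -> 0 <= opnorm T.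
Proof.
move=> bT d0; apply: le_trans (hnorm_ge0 (T 0)) _.
by apply: le_opnorm; rewrite // hnorm0.
Qed.

Lemma opnorm_le (T : op H1 H2) (k : R) : dom T 0 ->
  (forall x, dom T x -> hnorm x <= 1 -> hnorm (T x) <= k) -> opnorm T <= k.
Proof.
move=> d0 bT; apply: ge_sup; last by move=> _ [x [dx x1 ->]]; exact: bT.
by exists (hnorm (T 0)), 0; rewrite hnorm0.
Qed.

(** The vector is normalised by a real scalar, which lies in every slice, so linearity over
    $\mathbb{C}_m$ suffices. *)
Lemma hnorm_le_opnorm (T : op H1 H2) x : linear_over (Cslice m) T ->
  bounded_op T -> dom T x -> hnorm (T x) <= opnorm T * hnorm x.
Proof.
move=> lT bT dx; have [x0|x0] := eqVneq (hnorm x) 0.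
  by rewrite (hnorm_eq0 x0) (linear_over0 lT Cslice1) !hnorm0 mulr0.
have xgt0 : 0 < hnorm x by rewrite lt_neqAle eq_sym x0 hnorm_ge0.
have CR : Cslice m (quat_real (hnorm x)^-1).
  by apply/Cslice_comm; rewrite ?quat_realC.
have [dy Ty] := linear_overZ lT Cslice1 CR dx.
have normZ (H : quatHilbertType R) (z : H) :
    hnorm (z *; quat_real (hnorm x)^-1) = (hnorm x)^-1 * hnorm z.
  by rewrite hnorm_real ger0_norm ?invr_ge0 ?hnorm_ge0.
rewrite -ler_pdivrMr // mulrC -normZ -Ty; apply: le_opnorm => //.
by rewrite normZ mulVf.
Qed.

Lemma tilde_ext_bounded (T : op H1 H2) : slice_operator J1 J2 m T ->
  bounded_op T -> forall x, dom (tilde_ext T) x ->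
  hnorm (tilde_ext T x) <= opnorm T * hnorm x.
Proof.
move=> sT bT; apply: tilde_ext_bound => //.
  by apply: opnorm_ge0 => //; case: sT => _ _ [].
by move=> x; apply: hnorm_le_opnorm => //; case: sT.
Qed.

Lemma opnorm_tilde_ext (T : op H1 H2) : slice_operator J1 J2 m T ->
  bounded_op T -> opnorm (tilde_ext T) = opnorm T.
Proof.
move=> sT bT; have [_ dE _ ET] := is_tilde_ext sT.
have [_ _ [d0 _ _]] := sT.
have dTE x : dom T x -> dom (tilde_ext T) x by rewrite -dE => -[].
have bE : bounded_op (tilde_ext T).
  by exists (opnorm T); exact: tilde_ext_bounded.
(* One inequality is the bound on the extension; the other holds because the extension agrees with
   [T] on [dom T]. *)
apply/eqP; rewrite eq_le; apply/andP; split; apply: opnorm_le => //.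
- exact: dTE.
- move=> x dx x1; apply: (le_trans (tilde_ext_bounded sT bT dx)).
  by rewrite ler_piMr // opnorm_ge0.
- by move=> x dx x1; rewrite -ET //; apply: le_opnorm => //; exact: dTE.
Qed.

End Extension.

Theorem theorem2p11 (R : realType) (H1 H2 : quatHilbertType R)
    (J1 : op H1 H1) (J2 : op H2 H2) (m : quat R)
    (hJ1 : anti_selfadjoint_unitary J1)
    (hJ2 : anti_selfadjoint_unitary J2)
    (hm : imag_sphere m) :
  (forall T : op H1 H2, slice_operator J1 J2 m T ->
     exists_unique_op (is_tilde J1 m T) /\
     forall Tt : op H1 H2, is_tilde J1 m T Tt ->
       (dom T = Hplus J1 m -> bounded_op T ->
          everywhere_bounded Tt /\ opnorm Tt = opnorm T) /\
       (forall x, dom Tt x -> J2 (Tt x) = Tt (J1 x)))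
  /\
  (forall V : op H1 H2, right_linear V ->
     (exists_unique_op (fun U : op H1 H2 =>
        [/\ slice_operator J1 J2 m U,
            dom U = dom V `&` Hplus J1 m &
            is_tilde J1 m U V])
      <->
      (forall x, dom V x -> dom V (J1 x)) /\
      (forall x, dom V x -> J2 (V x) = V (J1 x)))).
Proof.
have [n hn nm] := imag_sphere_anticomm hm.
have eqE T S := @is_tilde_eq_ext _ _ _ J1 J2 m n hJ1 hm hn nm T S.
(* By uniqueness the commutation relation passes from the explicit extension to any [Tt]. *)
have commE T Tt : slice_operator J1 J2 m T -> is_tilde J1 m T Tt ->
    forall x, dom Tt x -> J2 (Tt x) = Tt (J1 x).
  move=> sT tTt x dx; have [dE E] := eqE _ _ sT tTt.
  have [_ _ /(_ _ dx) dJx _] := tTt; rewrite (E _ dx) (E _ dJx).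
  by case: (tilde_ext_J (n := n) (x := x) hJ1 hJ2 hm sT) => //; rewrite -dE.
split=> [T sT|V lV].
  have tE := is_tilde_ext hJ1 hJ2 hm hn nm sT.
  split; first by exists (tilde_ext J1 m n T) => // S; exact: eqE.
  move=> Tt tTt; split=> [dT bT|]; last exact: commE tTt.
  have [dE E] := eqE _ _ sT tTt; split; last first.
    by rewrite (op_eq_opnorm (conj dE E)) (opnorm_tilde_ext hJ1 hJ2).
  have [lTt _ _ _] := tTt; split=> //.
    (* Every projection lands in the slice space, which is all of [dom T]. *)
    rewrite dE; apply/seteqP; split=> // x _ /=.
    by rewrite dT; split; exact: Hplus_proj_in.
  exists (opnorm T) => x dx; rewrite E //.
  by apply: (tilde_ext_bounded hJ1 hJ2 hm hn nm sT bT); rewrite -dE.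
split=> [[U [sU dU tU] _]|[dJ VJ]].
  by split; [case: tU|exact: commE tU].
(* The only candidate for [U] is the restriction of [V] to the slice space. *)
exists (Op (dom V `&` Hplus J1 m) V); last first.
  move=> S [_ dS [_ _ _ VS]]; split=> // x dx.
  by rewrite VS.
split=> //; split=> [x []//|x [dx Jx]|] /=.
(* Commutation with [J1] and [J2] is what makes [V] map slice vectors to slice vectors. *)
- rewrite /Hplus /= VJ // Jx.
  by case: (linear_overZ (q := m) lV I I dx).
- have [d0 dD VD] := lV; split=> /=.
  + by split; rewrite // /Hplus /= (anti_selfadjoint_unitary0 hJ1) rscale0l.
  + move=> x y q /(Cslice_comm _ hm) qm [dx Jx] [dy Jy]; split; first exact: dD.
    rewrite /Hplus /= (anti_selfadjoint_unitaryD hJ1).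
    rewrite (anti_selfadjoint_unitaryZ hJ1) Jx Jy rscaleDl !rscaleA.
    by rewrite qm.
  + by move=> x y q _ [dx _] [dy _]; exact: VD.
Qed.
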